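(* For every set $E\in\mathcal{E}$ and every Silver tree $T\subseteq 2^{<\omega}$ there is a Silver tree $T'\subseteq T$ such that for every $n\in\omega$ $$E+\underbrace{[T']+[T']+\dots+[T']}_{n\text{ times}}\in\mathcal{E}.$$
   Context: $\mathcal{E}$ denotes the $\sigma$-ideal of subsets of $2^\omega$ generated by closed null sets, i.e. $E\in\mathcal{E}$ iff $E$ is contained in a countable union of closed subsets of $2^\omega$ of measure zero for the standard product (Haar) probability measure. A tree is a nonempty set $T\subseteq 2^{<\omega}$ closed under initial segments. Write $\mathrm{split}(T)=\{\sigma\in T:\sigma^\frown 0\in T\text{ and }\sigma^\frown 1\in T\}$ and $[T]=\{x\in 2^\omega:(\forall n\in\omega)\ x\upharpoonright n\in T\}$. $T$ is perfect if for every $\sigma\in T$ there is $\tau\in\mathrm{split}(T)$ with $\sigma\subseteq\tau$. $T$ is a Silver tree if it is perfect and for all $\sigma,\tau\in T$ with $|\sigma|=|\tau|$ and all $i\in\{0,1\}$: $\sigma^\frown i\in T\iff\tau^\frown i\in T$. On $2^\omega$, $+$ is coordinatewise addition modulo $2$, and $A+B=\{a+b:a\in A,\ b\in B\}$ for $A,B\subseteq 2^\omega$; for $n=0$ the displayed set is read as $E$ itself. *)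

(* Defs.v *)
(* 2^omega is [cantor_space], and 2^{<omega} is [seq bool]
   with [false], [true] for the digits 0, 1. *)
From HB Require Import structures.
From mathcomp Require Import all_boot all_order all_algebra.
From mathcomp Require Import all_classical all_reals all_analysis.
Import Order.TTheory GRing.Theory Num.Theory.
Import numFieldNormedType.Exports.

Set Implicit Arguments.
Unset Strict Implicit.
Unset Printing Implicit Defensive.

Local Open Scope classical_set_scope.
Local Open Scope ring_scope.

Definition restr (x : cantor_space) (n : nat) : seq bool := mkseq x n.

Definition cylinder (s : seq bool) : set cantor_space :=
  [set x | restr x (size s) = s].

Lemma restrS (x : cantor_space) n : restr x n.+1 = rcons (restr x n) (x n).
Proof. by rewrite /restr /mkseq -addn1 iotaD map_cat cats1. Qed.

Lemma size_restr (x : cantor_space) n : size (restr x n) = n.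
Proof. exact: size_mkseq. Qed.

Lemma take_restr (x : cantor_space) m n :
  (m <= n)%N -> take m (restr x n) = restr x m.
Proof.
by move=> le_mn; rewrite /restr /mkseq -map_take take_iota (minn_idPl le_mn).
Qed.

Lemma mem_cylinder_restr (x : cantor_space) n : cylinder (restr x n) x.
Proof. by rewrite /cylinder /= size_restr. Qed.

Lemma cylinder_restrP (x y : cantor_space) n :
  cylinder (restr x n) y <-> forall i, (i < n)%N -> y i = x i.
Proof.
rewrite /cylinder /= size_restr; split=> [e i lt_in|e].
  by have := congr1 (nth false ^~ i) e; rewrite !nth_mkseq.
apply: (@eq_from_nth _ false); rewrite !size_restr // => i lt_in.
by rewrite !nth_mkseq // e.
Qed.

Lemma open_cylinderP (U : set cantor_space) (x : cantor_space) :
  open U -> U x -> exists n, cylinder (restr x n) `<=` U.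
Proof.
move=> oU Ux.
pose F := filter_from [set: nat] (fun n => cylinder (restr x n)).
have FF : Filter F.
  apply: filter_from_filter; first by exists 0%N.
  move=> i j _ _; exists (maxn i j) => // y /cylinder_restrP e.
  by split; apply/cylinder_restrP => k lt; apply: e; rewrite leq_max lt ?orbT.
have FFx : F --> (x : cantor_space).
  apply/cvg_sup => i; apply/cvg_image.
    by rewrite eqEsubset; split=> // b _; exists (fun=> b).
  move=> A /= Ax; exists ((fun f : cantor_space => f i) @^-1` A).
    exists i.+1 => // y /cylinder_restrP /(_ i (ltnSn i)) /= ->.
    exact: nbhs_singleton.
  rewrite eqEsubset; split=> [b [y /= Ay <-]//|b Ab].
  by exists (fun=> b).
have [|n _ sU] := FFx U; first exact: open_nbhs_nbhs.
by exists n.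
Qed.

Lemma open_cylinder (s : seq bool) : open (cylinder s).
Proof.
elim/last_ind: s => [|s b IH].
  rewrite (_ : cylinder [::] = setT); first exact: openT.
  exact/seteqP.
rewrite (_ : cylinder (rcons s b) = cylinder s `&`
    ((fun f : cantor_space => f (size s)) @^-1` [set b])); last first.
  rewrite eqEsubset /cylinder size_rcons; split=> x /=; rewrite restrS.
    by move=> /rcons_inj[-> ->].
  by move=> [-> ->].
apply: openI => //; apply: open_comp; last exact: discrete_open.
by move=> x _; exact: (@proj_continuous _ (fun=> bool) (size s) x).
Qed.

Definition cantor_borel := g_sigma_algebraType (@open cantor_space).

Lemma measurable_cylinder (s : seq bool) :
  measurable (cylinder s : set cantor_borel).
Proof. by apply: sub_sigma_algebra; exact: open_cylinder. Qed.

Lemma open_bigcup_cylinder (U : set cantor_space) : open U ->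
  U = \bigcup_(s in [set s | cylinder s `<=` U]) cylinder s.
Proof.
move=> oU; rewrite eqEsubset; split=> x; last by case=> s /= sU /sU.
move=> Ux; have [n nU] := open_cylinderP oU Ux.
by exists (restr x n) => //; exact: mem_cylinder_restr.
Qed.

(* Existence of the product measure: push Lebesgue measure on [0, 1[ forward
   along the binary digits map. *)
Section existence.
Variable R : realType.

Let digits (x : R) : cantor_borel :=
  if 0 <= x < 1 then (fun n => odd (Num.truncn (x * 2 ^+ n.+1)))
  else (fun=> false).

Let val2 (s : seq bool) : nat := foldl (fun (k : nat) (b : bool) => k.*2 + b)%N 0%N s.

Let val2_rcons s b : val2 (rcons s b) = ((val2 s).*2 + b)%N.
Proof. by rewrite /val2 foldl_rcons. Qed.

Let truncn_double (y : R) : 0 <= y -> (Num.truncn (y * 2))./2 = Num.truncn y.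
Proof.
move=> y0; have y20 : 0 <= y * 2 by rewrite mulr_ge0.
have /andP[h1 h2] := truncn_itv y20.
symmetry; apply: truncn_def; apply/andP; split.
  rewrite -(ler_pM2r (ltr0Sn R 1)) (le_trans _ h1) // -natrM ler_nat.
  by rewrite muln2 -{2}(odd_double_half (Num.truncn (y * 2))) leq_addl.
rewrite -(ltr_pM2r (ltr0Sn R 1)) (lt_le_trans h2) // -natrM ler_nat.
rewrite muln2 doubleS -{1}(odd_double_half (Num.truncn (y * 2))).
by case: odd.
Qed.

Let digitsP (x : R) (s : seq bool) : 0 <= x < 1 ->
  cylinder s (digits x) <-> Num.truncn (x * 2 ^+ size s) = val2 s.
Proof.
move=> x01; have /andP[x0 x1] := x01.
rewrite /cylinder /=.
elim/last_ind: s => [|s b IH].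
  rewrite /= expr0 mulr1 /val2 /=; split=> // _.
  by apply: truncn_def; rewrite x0.
rewrite size_rcons restrS val2_rcons {2}/digits x01.
have := @truncn_double (x * 2 ^+ size s) _.
rewrite -mulrA -exprSr => e; move: IH; rewrite -{}e; last by rewrite mulr_ge0 // exprn_ge0.
set t := Num.truncn (x * 2 ^+ (size s).+1).
move=> IH'; rewrite -/t; split.
  move=> /rcons_inj[/IH' e ot]; rewrite -ot -e -[LHS]odd_double_half.
  by rewrite addnC.
move=> et; congr rcons; first by apply/IH'; rewrite et addnC half_bit_double.
by rewrite et oddD odd_double; case: (b).
Qed.

Let val2_lt s : (val2 s < 2 ^ size s)%N.
Proof.
elim/last_ind: s => // s b IH; rewrite val2_rcons size_rcons expnS mul2n.
case: b; rewrite -!mul2n ?addn1 ?addn0; last by rewrite ltn_pmul2l.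
by apply: (@leq_trans (2 * (val2 s).+1)%N); rewrite ?leq_pmul2l // mulnS.

Qed.

Let itvE (s : seq bool) :
  (digits @^-1` cylinder s) `&` `[0, 1[ =
  `[(val2 s)%:R / 2 ^+ size s, (val2 s).+1%:R / 2 ^+ size s[%classic.
Proof.
have p2 : 0 < 2 ^+ size s :> R by rewrite exprn_gt0.
rewrite eqEsubset; split=> x /=; rewrite !in_itv/=.
  move=> [cx x01]; move/(digitsP _ x01) : cx => <-.
  rewrite ler_pdivrMr // ltr_pdivlMr //; apply: truncn_itv.
  by case/andP: x01 => x0 _; rewrite mulr_ge0 // ltW.
rewrite ler_pdivrMr // ltr_pdivlMr // => h; have /andP[h1 h2] := h.
have x01 : 0 <= x < 1.
  apply/andP; split.
    by rewrite -(pmulr_lge0 _ p2) (le_trans _ h1).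
  rewrite -(ltr_pM2r p2) mul1r (lt_le_trans h2) //.
  by rewrite -natrX ler_nat val2_lt.
by split=> //; apply/digitsP => //; exact: truncn_def.
Qed.

Let measurable_digits : measurable_fun [set: R] digits.
Proof.
apply: (measurability (@open cantor_space : set (set cantor_borel))) => // _ [U oU <-].
rewrite setTI (open_bigcup_cylinder oU) preimage_bigcup.
rewrite bigcup_mkcond; apply: countable_bigcupT_measurable => // s.
case: ifPn => // _.
rewrite -(setIT (_ @^-1` _)) -(setvU `[0, 1[%classic) setIUr.
apply: measurableU; last by rewrite itvE.
pose z : cantor_borel := fun=> false.
have [zs|zs] := pselect (cylinder s z).
  rewrite (_ : _ `&` _ = ~` `[0, 1[%classic); first exact: measurableC.
  apply/setIidr => x /=; rewrite in_itv/= /digits => /negP/negbTE -> //.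
rewrite (_ : _ `&` _ = set0) //; apply/seteqP; split=> // x /= [].
by rewrite in_itv/= => + /negP/negbTE x01; rewrite /digits x01.
Qed.

Let mI : measurable (`[0, 1[%classic : set R). Proof. by []. Qed.

Definition digits_law : set cantor_borel -> \bar R :=
  pushforward (mrestr (@lebesgue_measure R) mI) digits.

Let digits_law_cylinder s : digits_law (cylinder s) = (2^-1 ^+ size s)%:E.
Proof.
have p2 : 0 < 2 ^+ size s :> R by rewrite exprn_gt0.
rewrite /digits_law /pushforward /mrestr itvE lebesgue_measure_itv/= lte_fin.
rewrite ltr_pM2r ?invr_gt0 // ltr_nat ltnSn -EFinD -mulrBl -natrB //.
by rewrite subSnn mul1r exprVn.
Qed.

Let digits_law0 : digits_law set0 = 0%E.
Proof. by rewrite /digits_law /pushforward preimage_set0 measure0. Qed.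

Let digits_law_ge0 A : (0 <= digits_law A)%E.
Proof. by rewrite /digits_law /pushforward measure_ge0. Qed.

Let digits_law_sigma_additive : semi_sigma_additive digits_law.
Proof.
move=> F mF tF mUF; rewrite /digits_law /pushforward preimage_bigcup.
apply: measure_semi_sigma_additive.
- by move=> n; rewrite -[X in measurable X]setTI; exact: measurable_digits.
- apply/trivIsetP => /= i j _ _ ij; rewrite -preimage_setI.
  by move/trivIsetP : tF => /(_ _ _ _ _ ij) ->//; rewrite preimage_set0.
- by rewrite -preimage_bigcup -[X in measurable X]setTI; exact: measurable_digits.
Qed.

HB.instance Definition _ := isMeasure.Build _ _ _ digits_law
  digits_law0 digits_law_ge0 digits_law_sigma_additive.

Let digits_law_setT : digits_law setT = 1%E.
Proof.
rewrite (_ : setT = cylinder [::]); first by rewrite digits_law_cylinder expr0.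
exact/seteqP.
Qed.

HB.instance Definition _ := Measure_isProbability.Build _ _ _ digits_law digits_law_setT.

Lemma ex_coin_measure : exists mu : probability cantor_borel R,
  forall s, mu (cylinder s) = (2^-1 ^+ size s)%:E.
Proof. by exists digits_law. Qed.

End existence.

(* The standard product (Haar) probability measure on the Borel sets of
   2^omega, pinned down by its values on cylinders. *)
Definition coin_measure (R : realType) : probability cantor_borel R :=
  sval (cid (ex_coin_measure R)).

Lemma coin_measure_cylinder (R : realType) (s : seq bool) :
  coin_measure R (cylinder s) = (2^-1 ^+ size s)%:E.
Proof. exact: (svalP (cid (ex_coin_measure R))). Qed.

Lemma coin_measure_unique (R : realType) (mu : probability cantor_borel R) :
  (forall s, mu (cylinder s) = (2^-1 ^+ size s)%:E) ->
  forall A, measurable A -> mu A = coin_measure R A.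
Proof.
move=> mu_cyl.
pose G : set (set cantor_borel) :=
  [set A | A = set0 \/ exists s, A = cylinder s].
have cylT : cylinder [::] = setT by exact/seteqP.
have mG : @measurable _ cantor_borel = <<s G >>.
  apply/seteqP; split.
    apply: smallest_sub; first exact: smallest_sigma_algebra.
    move=> U oU; rewrite (open_bigcup_cylinder oU) bigcup_mkcond.
    pose C := g_sigma_algebraType G.
    apply: (@countable_bigcupT_measurable _ C) => // s.
    case: ifPn => // _; apply: sub_sigma_algebra; right; by exists s.
  apply: smallest_sub; first exact: sigma_algebra_measurable.
  by move=> _ [->|[s ->]] //; exact: measurable_cylinder.
apply: (@measure_unique _ _ cantor_borel G (fun=> [set: cantor_borel])) => //.
- move=> A B [->|[s ->]]; first by rewrite set0I => _; left.
  move=> [->|[t ->]]; first by rewrite setI0; left.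
  wlog le_st : s t / (size s <= size t)%N.
    by move=> h; case/orP: (leq_total (size s) (size t)) => /h //; rewrite setIC.
  have [st|st] := pselect (take (size s) t = s).
    right; exists t; apply/setIidr => x; rewrite /cylinder /= => xt.
    by rewrite -(take_restr x le_st) xt.
  left; apply/seteqP; split=> // x [] /=; rewrite /cylinder /= => xs xt; apply: st.
  by rewrite -xt take_restr.
- by move=> _; right; exists [::].
- by rewrite bigcup_const.
- move=> _ [->|[s ->]]; first by rewrite !measure0.
  exact: (eq_trans (mu_cyl s) (esym (coin_measure_cylinder R s))).
- by move=> _; rewrite /= probability_setT ltry.
Qed.

(* Subsets of countable unions of closed null sets: the sigma-ideal they generate. *)
Definition closed_null_ideal (R : realType) : set (set cantor_space) :=
  [set E | exists F : nat -> set cantor_space,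
    (forall k, closed (F k) /\ coin_measure R (F k) = 0%E) /\
    E `<=` \bigcup_k F k].

Definition is_tree (T : set (seq bool)) : Prop :=
  T !=set0 /\ forall s t, prefix s t -> T t -> T s.

Definition split_nodes (T : set (seq bool)) : set (seq bool) :=
  [set s | T s /\ T (rcons s false) /\ T (rcons s true)].

Definition branches (T : set (seq bool)) : set cantor_space :=
  [set x | forall n, T (restr x n)].

Definition perfect_tree (T : set (seq bool)) : Prop :=
  is_tree T /\ forall s, T s -> exists2 t, split_nodes T t & prefix s t.

Definition silver_tree (T : set (seq bool)) : Prop :=
  perfect_tree T /\
  forall s t, T s -> T t -> size s = size t ->
    forall i : bool, T (rcons s i) <-> T (rcons t i).

Definition cantor_add (x y : cantor_space) : cantor_space :=
  fun n => x n (+) y n.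

Definition sumset (A B : set cantor_space) : set cantor_space :=
  [set cantor_add a b | a in A & b in B].

(* E + A + ... + A with n copies of A; this is E for n = 0. *)
Definition sumset_iter (E A : set cantor_space) (n : nat) : set cantor_space :=
  iter n (fun X => sumset X A) E.

(* Main.v *)
Require Import Defs.
From HB Require Import structures.
From mathcomp Require Import all_boot all_order all_algebra.
From mathcomp Require Import all_classical all_reals all_analysis.
Import Order.TTheory GRing.Theory Num.Theory.

Set Implicit Arguments.
Unset Strict Implicit.
Unset Printing Implicit Defensive.

Local Open Scope classical_set_scope.

(** A Silver tree is given by an infinite set [A] of splitting levels together
with one forced digit [c n] at every other level [n].  Shrinking [A] to an
infinite [B] and forcing the digits [c] off [B] gives a Silver subtree [T'],
and every sum of [n] branches of [T'] is [n] times [c] plus a point of the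
group [2^B] of points supported in [B].  Since the ideal is translation
invariant, all the sums are handled at once as soon as the set [E + 2^B] is in
the ideal ([sumset_iter_branches]), so everything reduces to finding a sparse
[B] in [A] with that property ([closed_null_ideal_sparse]).

Let [E] be covered by closed null sets [F k].  For each [m], let [G m] be the
union of the [F k], [k <= m], saturated under changes of the digits below [m].
It is a finite union of translates of closed null sets, hence closed and null,
hence the clopen sets [approx (G m) n], which look at the first [n] digits
only, decrease to it and their measures tend to [0]; let [f m] be an [n] for
which the measure is below [1 / (m + 1)].  Now choose the elements
[a 0 < a 1 < ...] of [B] inside [A] so that [f (a j + 1) <= a (j + 1)].  Given
[x] in [F k] and [d] supported in [B], split [d] into its digits up to [a j]
and those from [a (j + 1)] on: adding the former to [x] lands in
[G (a j + 1)] for [k <= j], and adding the latter does not affect the first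
[f (a j + 1)] digits.  So [F k + 2^B] is contained in the intersection over
[j >= k] of clopen sets of measure tending to [0]. *)

(** * Addition and cylinders in the Cantor space *)

Lemma cantor_addA x y z :
  cantor_add x (cantor_add y z) = cantor_add (cantor_add x y) z.
Proof. by apply/funext => i; rewrite /cantor_add addbA. Qed.

Lemma cantor_addC x y : cantor_add x y = cantor_add y x.
Proof. by apply/funext => i; rewrite /cantor_add addbC. Qed.

Lemma cylinder_add x y n :
  cantor_add x @^-1` cylinder (restr y n) = cylinder (restr (cantor_add x y) n).
Proof.
apply/seteqP; split=> z /= /cylinder_restrP e; apply/cylinder_restrP => i /e.
  by rewrite /cantor_add => <-; rewrite addKb.
by rewrite /cantor_add => ->; rewrite addKb.
Qed.

Lemma cylinder_open (U : set cantor_space) :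
  (forall x, U x -> exists n, cylinder (restr x n) `<=` U) -> open U.
Proof.
move=> hU; rewrite openE => x /hU[n nU]; apply: filterS nU _.
apply: open_nbhs_nbhs; split; first exact: open_cylinder.
exact: mem_cylinder_restr.
Qed.

Lemma continuous_cantor_add x :
  continuous (cantor_add x : cantor_space -> cantor_space).
Proof.
apply/continuousP => U oU; apply: cylinder_open => y /= Uxy.
have [n nU] := open_cylinderP oU Uxy; exists n => z yz; apply: nU.
move: yz => /cylinder_restrP e; apply/cylinder_restrP => i /e.
by rewrite /cantor_add => ->.
Qed.

Lemma measurable_closed (F : set cantor_space) :
  closed F -> measurable (F : set cantor_borel).
Proof.
move=> cF; rewrite -[F]setCK; apply: (@measurableC _ cantor_borel).
by apply: sub_sigma_algebra; exact: closed_openC.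
Qed.

(** * Closed null sets *)

Definition closed_null (R : realType) (F : set cantor_space) : Prop :=
  closed F /\ coin_measure R F = 0%E.

(** The translate of the coin measure is a probability with the same values
on cylinders. *)
Lemma coin_measure_translate (R : realType) x (A : set cantor_borel) :
  measurable A -> coin_measure R (cantor_add x @^-1` A) = coin_measure R A.
Proof.
move=> mA; pose f : cantor_borel -> cantor_borel := cantor_add x.
have mf : measurable_fun setT f.
  apply: (measurability (@open cantor_space : set (set cantor_borel))) => //.
  move=> _ [U oU <-]; rewrite setTI; apply: sub_sigma_algebra.
  by apply: open_comp oU => y _; exact: continuous_cantor_add.
pose mf_mixin := isMeasurableFun.Build _ _ _ _ _ mf.
pose X : {mfun cantor_borel >-> cantor_borel} := HB.pack f mf_mixin.
apply: (@coin_measure_unique R (distribution (coin_measure R) X)) => // s.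
rewrite /= /distribution /pushforward /=.
(* every string is the restriction of a point, padded with any digit *)
pose y : cantor_space := nth false s.
have -> : s = restr y (size s) by rewrite /restr mkseq_nth.
by rewrite /f cylinder_add !coin_measure_cylinder !size_restr.
Qed.

Lemma closed_null_translate (R : realType) x (F : set cantor_space) :
  closed_null R F -> closed_null R (cantor_add x @^-1` F).
Proof.
move=> [cF F0]; split.
  by apply: preimage_closed => // y _; exact: continuous_cantor_add.
by rewrite coin_measure_translate //; exact: measurable_closed.
Qed.

Lemma closed_nullU (R : realType) (F G : set cantor_space) :
  closed_null R F -> closed_null R G -> closed_null R (F `|` G).
Proof.
move=> [cF F0] [cG G0]; split; first exact: closedU.
by apply: null_set_setU => //; exact: measurable_closed.
Qed.

Lemma closed_null_prefix_union (R : realType) (F : nat -> set cantor_space) m :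
  (forall k, closed_null R (F k)) ->
  exists2 G, closed_null R G & forall k, (k <= m)%N -> F k `<=` G.
Proof.
move=> nF; elim: m => [|m [G nG sG]].
  by exists (F 0) => // k; rewrite leqn0 => /eqP ->.
exists (G `|` F m.+1); first exact: closed_nullU.
move=> k; rewrite leq_eqVlt => /orP[/eqP -> x|/sG sFG x /sFG]; first by right.
by left.
Qed.

Definition supported (B : set nat) : set cantor_space :=
  [set d | forall i, d i -> B i].

(** Changing the digits below [m] is adding one of finitely many points: one
unions with the translate by the unit vector of one level at a time. *)
Lemma closed_null_saturate (R : realType) (F : set cantor_space) m :
  closed_null R F ->
  exists2 G, closed_null R G & sumset F (supported [set i | (i < m)%N]) `<=` G.
Proof.
move=> nF; elim: m => [|m [G nG sG]].
  exists F => // _ [x Fx] [d sd] <-.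
  suff -> : cantor_add x d = x by [].
  by apply/funext => i; rewrite /cantor_add; case: (d i) (sd i) => [/(_ isT)//|]; rewrite addbF.
pose e : cantor_space := fun i => i == m.
exists (G `|` (cantor_add e @^-1` G)).
  by apply: closed_nullU => //; exact: closed_null_translate.
move=> _ [x Fx] [d sd] <-.
have [dm|dm] := boolP (d m); [right|left]; apply: sG.
  rewrite [X in _ X](_ : _ = cantor_add x (cantor_add e d)); last first.
    by rewrite cantor_addA [cantor_add e x]cantor_addC -cantor_addA.
  exists x => //; exists (cantor_add e d) => // i /=.
  rewrite /cantor_add /e; have [->|im] := eqVneq i m; first by rewrite dm.
  by rewrite addFb => /sd /=; rewrite ltnS leq_eqVlt (negPf im).
exists x => //; exists d => // i /= di.
have /= := sd i di; rewrite ltnS leq_eqVlt => /orP[/eqP im|//].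
by rewrite -im di in dm.
Qed.

(** * Clopen approximations of a closed set *)

Definition approx (G : set cantor_space) (n : nat) : set cantor_space :=
  [set y | exists2 x, G x & cylinder (restr x n) y].

Lemma approx_le (G : set cantor_space) m n :
  (m <= n)%N -> approx G n `<=` approx G m.
Proof.
move=> le_mn y [x Gx /cylinder_restrP e]; exists x => //.
by apply/cylinder_restrP => i lt_im; apply: e; exact: leq_trans le_mn.
Qed.

Lemma closed_approx (G : set cantor_space) n : closed (approx G n).
Proof.
rewrite -openC; apply: cylinder_open => y Gy; exists n.
move=> z /cylinder_restrP ez [x Gx /cylinder_restrP ex]; apply: Gy.
by exists x => //; apply/cylinder_restrP => i lt_in; rewrite -ez // ex.
Qed.

Lemma closed_bigcap_approx (G : set cantor_space) :
  closed G -> \bigcap_n approx G n = G.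
Proof.
move=> cG; apply/seteqP; split=> x; last first.
  by move=> Gx n _; exists x => //; exact: mem_cylinder_restr.
move=> Ax; apply: contrapT => nGx.
have [n nG] := open_cylinderP (closed_openC cG) nGx.
have [y Gy /cylinder_restrP e] := Ax n I.
by apply: (nG y) => //; apply/cylinder_restrP => i /e.
Qed.

(** Continuity of the measure from above, along the decreasing clopen sets. *)
Lemma closed_null_approx (R : realType) (G : set cantor_space) (e : R) :
  closed_null R G -> (0 < e)%R ->
  exists n, (coin_measure R (approx G n) < e%:E)%E.
Proof.
move=> [cG G0] e0.
have capG := closed_bigcap_approx cG.
have cvgG : (coin_measure R \o approx G) n @[n --> \oo] --> 0%E.
  rewrite -G0 -{2}capG; apply: nonincreasing_cvg_mu.
  - by rewrite (le_lt_trans (probability_le1 _ _)) ?ltry //;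
      apply: measurable_closed; exact: closed_approx.
  - by move=> n; apply: measurable_closed; exact: closed_approx.
  - by rewrite capG; exact: measurable_closed.
  - by move=> m n le_mn; apply/subsetPset; exact: approx_le.
have [|N _ hN] := cvgG [set z | z < e%:E]%E; last first.
  by exists N; apply: (hN N) => /=.
by apply: open_nbhs_nbhs; split; [exact: open_ereal_lt_ereal | rewrite /= lte_fin].
Qed.

Lemma bigcap_null (R : realType) (C : nat -> set cantor_space) k :
  (forall j, measurable (C j : set cantor_borel)) ->
  (forall j, coin_measure R (C j) < (j.+1%:R^-1)%:E)%E ->
  coin_measure R (\bigcap_(j in [set j | (k <= j)%N]) C j) = 0%E.
Proof.
move=> mC ltC; apply/eqP; rewrite eq_le measure_ge0 andbT.
apply/lee_addgt0Pr => e e0; rewrite add0e.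
have [N _ hN] := near_infty_natSinv_lt (PosNum e0).
pose j := maxn k N.
apply: (@le_trans _ _ (coin_measure R (C j))); last first.
  rewrite (le_trans (ltW (ltC j))) // lee_fin ltW //.
  by apply: (hN j); rewrite /= leq_maxr.
apply: le_measure; rewrite ?inE //.
  by apply: (@bigcap_measurable _ cantor_borel) => //; exists k => /=.
by apply: bigcap_inf; rewrite /= leq_maxl.
Qed.

(** * Sparse sets of levels *)

Definition unbounded (A : set nat) : Prop :=
  forall N, exists2 n, A n & (N <= n)%N.

(** Bounding each gap from below by a function of its left end lets the next
element depend on the last one only. *)
Lemma unbounded_sparse (A : set nat) (f : nat -> nat) : unbounded A ->
  exists a : nat -> nat,
    [/\ forall j, A (a j), {mono a : i j / (i < j)%N} &
        forall j, (f (a j) <= a j.+1)%N].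
Proof.
move=> uA.
have [g /all_and2[Ag leg]] : {g : nat -> nat &
    forall i, A (g i) /\ (maxn i.+1 (f i) <= g i)%N}.
  apply: (@choice _ _ (fun i n => A n /\ (maxn i.+1 (f i) <= n)%N)) => i.
  by have [n An le_n] := uA (maxn i.+1 (f i)); exists n.
exists (fun j => iter j g (g 0)); split=> [[|j]||j]; first exact: (Ag 0).
- exact: (Ag (iter j g (g 0))).
- apply: leqW_mono; apply: leq_mono; apply: homo_ltn ltn_trans _ => j.
  by apply: leq_trans (leg _); rewrite leq_maxl.
- by apply: leq_trans (leg _); rewrite leq_maxr.
Qed.

Lemma unbounded_range (a : nat -> nat) :
  {mono a : i j / (i < j)%N} -> unbounded (range a).
Proof.
move=> mono_a N; exists (a N); first by exists N.
elim: N => // N IH; apply: leq_ltn_trans IH _.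
by rewrite mono_a.
Qed.

(** One [B] serves all the [F k] at once, because [G m] below takes care of
all of the sets with index at most [m] and each [F k] only needs the clopen
sets from the [k]-th on. *)
Lemma closed_null_sparse (R : realType) (F : nat -> set cantor_space)
    (A : set nat) :
  (forall k, closed_null R (F k)) -> unbounded A ->
  exists B : set nat, [/\ B `<=` A, unbounded B &
    forall k, exists2 H, closed_null R H & sumset (F k) (supported B) `<=` H].
Proof.
move=> nF uA.
have [G /all_and2[nG FG]] : {G : nat -> set cantor_space &
    forall m, closed_null R (G m) /\ forall k, (k <= m)%N ->
      sumset (F k) (supported [set i | (i < m)%N]) `<=` G m}.
  apply: (@choice _ _ (fun m G => closed_null R G /\
    forall k, (k <= m)%N ->
      sumset (F k) (supported [set i | (i < m)%N]) `<=` G)) => m.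
  have [U nU FU] := closed_null_prefix_union m nF.
  have [G nG UG] := closed_null_saturate m nU.
  exists G; split=> // k /FU FkU _ [x /FkU Ux] [d sd] <-.
  by apply: UG; exists x => //; exists d.
have [f ltf] : {f : nat -> nat & forall m,
    (coin_measure R (approx (G m) (f m)) < (m.+1%:R^-1)%:E)%E}.
  apply: (@choice _ _ (fun m n =>
    (coin_measure R (approx (G m) n) < (m.+1%:R^-1)%:E)%E)) => m.
  by apply: closed_null_approx; rewrite ?invr_gt0 ?ltr0Sn.
have [a [Aa mono_a lea]] := unbounded_sparse (fun i => f i.+1) uA.
have le_a j : (j <= a j)%N.
  by elim: j => // j IH; apply: leq_ltn_trans IH _; rewrite mono_a.
exists (range a); split=> [_ [j _ <-]//||k]; first exact: unbounded_range.
pose C j := approx (G (a j).+1) (f (a j).+1).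
exists (\bigcap_(j in [set j | (k <= j)%N]) C j).
  split; first by apply: closed_bigI => j _; exact: closed_approx.
  apply: bigcap_null => j; first by apply: measurable_closed; exact: closed_approx.
  apply: lt_trans (ltf _) _; rewrite lte_fin ltf_pV2 ?posrE ?ltr0Sn //.
  by rewrite ltr_nat !ltnS le_a.
move=> _ [x Fx] [d sd] <- j /= le_kj.
pose d0 : cantor_space := fun i => (i <= a j)%N && d i.
exists (cantor_add x d0).
  apply: (FG _ k); first by rewrite (leq_trans le_kj) // leqW.
  by exists x => //; exists d0 => // i /andP[].
apply/cylinder_restrP => i lt_if; rewrite /cantor_add /d0; congr addb.
have [//|lt_ji] := leqP i (a j); apply/negbTE/negP => /sd[l _ ali].
(* [B] has no element strictly between [a j] and [a j.+1] *)
have : (a l < a j.+1)%N by rewrite ali; exact: leq_trans (lea j).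
by move: lt_ji; rewrite -ali !mono_a ltnS ltnNge => /negbTE ->.
Qed.

Lemma closed_null_ideal_sub (R : realType) (E E' : set cantor_space) :
  E' `<=` E -> closed_null_ideal R E -> closed_null_ideal R E'.
Proof. by move=> E'E [F [nF EF]]; exists F; split=> // x /E'E /EF. Qed.

Lemma closed_null_ideal_translate (R : realType) x (E : set cantor_space) :
  closed_null_ideal R E -> closed_null_ideal R (cantor_add x @^-1` E).
Proof.
move=> [F [nF EF]]; exists (fun k => cantor_add x @^-1` F k); split.
  by move=> k; exact: closed_null_translate.
by move=> y /= /EF[k _ Fk]; exists k.
Qed.

Lemma closed_null_ideal_sparse (R : realType) (E : set cantor_space)
    (A : set nat) :
  closed_null_ideal R E -> unbounded A ->
  exists B : set nat, [/\ B `<=` A, unbounded B &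
    closed_null_ideal R (sumset E (supported B))].
Proof.
move=> [F [nF EF]] uA; have [B [BA uB hB]] := closed_null_sparse nF uA.
exists B; split=> //.
have [H nH] : {H : nat -> set cantor_space & forall k,
    closed_null R (H k) /\ sumset (F k) (supported B) `<=` H k}.
  apply: (@choice _ _ (fun k H =>
    closed_null R H /\ sumset (F k) (supported B) `<=` H)) => k.
  by have [H] := hB k; exists H.
exists H; split=> [k|_ [x /EF[k _ Fx]] [d sd] <-]; first by have [] := nH k.
by exists k => //; apply: (nH k).2; exists x => //; exists d.
Qed.

(** * Silver trees *)

(** Every Silver tree has this form, with [B] its set of splitting levels and
[c] the digits it forces elsewhere. *)
Definition silver_of (B : set nat) (c : nat -> bool) : set (seq bool) :=
  [set s | forall i, (i < size s)%N -> ~ B i -> nth false s i = c i].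

Lemma silver_of_rcons B c s b :
  silver_of B c (rcons s b) <->
  silver_of B c s /\ (B (size s) \/ b = c (size s)).
Proof.
rewrite /silver_of /= size_rcons; split=> [h|[hs hb] i].
  split=> [i lt_i nBi|].
    by have := h i (ltnW lt_i) nBi; rewrite nth_rcons lt_i.
  have [Bs|nBs] := pselect (B (size s)); [by left|right].
  by have := h _ (ltnSn _) nBs; rewrite nth_rcons ltnn eqxx.
rewrite ltnS leq_eqVlt nth_rcons => /orP[/eqP ->|lt_i] nB.
  by rewrite ltnn eqxx; case: hb.
by rewrite lt_i; exact: hs.
Qed.

Lemma silver_tree_silver_of B c : unbounded B -> silver_tree (silver_of B c).
Proof.
move=> uB; split; last first.
  move=> s t Ts Tt est i; split=> /silver_of_rcons[_ h]; apply/silver_of_rcons.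
    by rewrite -est.
  by rewrite est.
split.
  split; first by exists [::].
  move=> s t /prefixP[u ->] Tt i lt_i nBi.
  have := Tt i; rewrite size_cat nth_cat lt_i; apply=> //.
  exact: leq_trans (leq_addr _ _).
move=> s Ts; have [n Bn le_n] := uB (size s).
(* continue [s] by the digits [c] up to a level in [B] *)
pose t := s ++ mkseq (fun i => c (size s + i)%N) (n - size s).
have size_t : size t = n by rewrite size_cat size_mkseq subnKC.
have Tt : silver_of B c t.
  move=> i; rewrite size_t => lt_in nBi; rewrite nth_cat.
  case: ltnP => [lt_i|le_i]; first exact: Ts.
  by rewrite nth_mkseq ?subnKC // ltn_sub2r // (leq_ltn_trans le_i).
exists t; last exact: prefix_prefix.
by split=> //; split; apply/silver_of_rcons; split=> //; left; rewrite size_t.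
Qed.

(** The forced digit at level [n] is [1] exactly when some node at that level
has no [0]-successor; by homogeneity this is then so for all of them. *)
Lemma silver_treeE (T : set (seq bool)) : silver_tree T ->
  exists A c, unbounded A /\ forall B, B `<=` A -> silver_of B c `<=` T.
Proof.
move=> [[[[s0 Ts0] clT] splT] homT].
have T0 : T [::] by apply: clT Ts0; exact: prefix0s.
have succT s : T s -> exists b, T (rcons s b).
  move=> /splT[t [_ [Tt _]] /prefixP[u tE]]; move: Tt; rewrite {}tE.
  case: u => [|b u]; first by rewrite cats0; exists false.
  rewrite -cat_rcons rcons_cat => Tt; exists b.
  by apply: clT Tt; exact: prefix_prefix.
pose A := [set n | exists2 s, split_nodes T s & size s = n].
pose c n := `[< exists s, [/\ T s, size s = n & ~ T (rcons s false)] >].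
have cT s : T s -> T (rcons s (c (size s))).
  move=> Ts; rewrite /c; case: asboolP => [[t [Tt ets nTt]]|h].
    have [[] // Tsf] := succT s Ts.
    by case: nTt; apply/(homT s t Ts Tt (esym ets)).
  by apply: contrapT => nT; apply: h; exists s.
exists A, c; split=> [N|B BA].
  have [s Ts <-] : exists2 s, T s & size s = N.
    elim: N => [|N [s /cT Ts <-]]; first by exists [::].
    by exists (rcons s (c (size s))) => //; rewrite size_rcons.
  have [t spl_t st] := splT s Ts; exists (size t); first by exists t.
  by case/prefixP: st => u ->; rewrite size_cat leq_addr.
elim/last_ind => // s b IH /silver_of_rcons[/IH Ts [/BA[t]|->]]; last exact: cT.
move=> [Tt [Ttf Ttt]] ets; apply/(homT s t Ts Tt (esym ets)).
by case: b.
Qed.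

Lemma branches_silver_of B c x :
  branches (silver_of B c) x -> supported B (cantor_add c x).
Proof.
move=> bx i; apply: contraPP => nBi.
have := bx i.+1 i; rewrite size_restr nth_mkseq // => /(_ (ltnSn i) nBi) xi.
by rewrite /cantor_add xi addbb.
Qed.

(** Each added branch translates by [c] and moves inside a coset of [2^B]. *)
Lemma sumset_iter_branches (R : realType) (E : set cantor_space) B c n :
  closed_null_ideal R (sumset E (supported B)) ->
  closed_null_ideal R (sumset_iter E (branches (silver_of B c)) n).
Proof.
move=> iE.
suff [W [iW WB EW]] : exists W, [/\ closed_null_ideal R W,
    sumset W (supported B) `<=` W &
    sumset_iter E (branches (silver_of B c)) n `<=` W].
  exact: closed_null_ideal_sub iW.
elim: n => [|n [W [iW WB EW]]].
  exists (sumset E (supported B)); split=> //.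
    move=> _ [_ [x Ex [d sd] <-]] [d' sd'] <-; rewrite -cantor_addA.
    exists x => //; exists (cantor_add d d') => // i.
    rewrite /cantor_add; case di: (d i) => /=; first by move=> _; exact: sd.
    exact: sd'.
  move=> x Ex; exists x => //; exists (fun=> false) => //.
  by apply/funext => i; rewrite /cantor_add addbF.
exists (cantor_add c @^-1` W); split; first exact: closed_null_ideal_translate.
  move=> _ [x Wx [d sd] <-] /=; rewrite cantor_addA; apply: WB.
  by exists (cantor_add c x) => //; exists d.
move=> _ [x /EW Wx [b /branches_silver_of sb] <-] /=; apply: WB.
exists x => //; exists (cantor_add c b) => //.
by rewrite !cantor_addA [cantor_add x c]cantor_addC.
Qed.

Theorem theorem20 (R : realType) (E : set cantor_space) (T : set (seq bool))
    (hE : closed_null_ideal R E) (hT : silver_tree T) :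
  exists T' : set (seq bool),
    silver_tree T' /\ T' `<=` T /\
    forall n : nat, closed_null_ideal R (sumset_iter E (branches T') n).
Proof.
have [A [c [uA AT]]] := silver_treeE hT.
have [B [BA uB iB]] := closed_null_ideal_sparse hE uA.
exists (silver_of B c); split; first exact: silver_tree_silver_of.
by split=> [|n]; [exact: AT | exact: sumset_iter_branches].
Qed.
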